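(* Let $(V,\mu,\nu)$ be an $IF$-normed space, let $p=(p_j)_{j\ge 0}\in SVA_+$, let $(x_{mn})_{m,n\ge 0}$ be a double sequence in $V$, let $x\in V$, and assume that $(x_{mn})$ is $(\bar N,p,*;1,0)$ summable to $x$. Then $x_{mn}\to x$ in $(V,\mu,\nu)$ if and only if for all $t>0$ $$\sup_{0<\lambda<1}\liminf_{m,n\to\infty}\mu\left(\frac{1}{P_m-P_{\lambda_m}}\sum_{j=\lambda_m+1}^{m}p_j(x_{mn}-x_{jn}),t\right)=1$$ and $$\inf_{0<\lambda<1}\limsup_{m,n\to\infty}\nu\left(\frac{1}{P_m-P_{\lambda_m}}\sum_{j=\lambda_m+1}^{m}p_j(x_{mn}-x_{jn}),t\right)=0.$$
   Context: An $IF$-normed space $(V,\mu,\nu)$ is a real vector space $V$ with zero vector $\theta$ together with functions (fuzzy sets) $\mu,\nu:V\times\mathbb{R}\to[0,1]$ such that for all $x,y\in V$ and $t,s\in\mathbb{R}$: (a) $\mu(x,t)=0$ for $t\le 0$; (b) $\mu(x,t)=1$ for all $t>0$ if and only if $x=\theta$; (c) $\mu(cx,t)=\mu(x,t/|c|)$ for all $t>0$ and real $c\neq 0$; (d) $\mu(x+y,t+s)\ge\min\{\mu(x,t),\mu(y,s)\}$; (e) $\lim_{t\to\infty}\mu(x,t)=1$, and $\lim_{t\to 0}\mu(x,t)=0$ if $x\ne\theta$; (f) $\nu(x,t)=1$ for $t\le 0$; (g) $\nu(x,t)=0$ for all $t>0$ if and only if $x=\theta$; (h) $\nu(cx,t)=\nu(x,t/|c|)$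 for all $t>0$ and real $c\ne 0$; (i) $\nu(x+y,t+s)\le\max\{\nu(x,t),\nu(y,s)\}$; (j) $\lim_{t\to\infty}\nu(x,t)=0$, and $\lim_{t\to 0}\nu(x,t)=1$ if $x\ne\theta$. A double sequence $(x_{mn})$ in $V$ converges to $x\in V$, written $x_{mn}\to x$, if for each $t>0$ and $\varepsilon\in(0,1)$ there is $n_0\in\mathbb{N}$ with $\mu(x_{mn}-x,t)>1-\varepsilon$ and $\nu(x_{mn}-x,t)<\varepsilon$ for all $m,n\ge n_0$. Limits of real double sequences are in Pringsheim's sense: $\liminf_{m,n\to\infty}a_{mn}=\lim_{N\to\infty}\inf_{m,n\ge N}a_{mn}$, and similarly for $\limsup$ (terms need only be defined for large $m,n$). The weight $p=(p_j)_{j\ge0}$ is a sequence of nonnegative reals with $p_0>0$ and $P_m=\sum_{j=0}^m p_j\to\infty$. Put $t^{10}_{mn}=\frac{1}{P_m}\sum_{j=0}^m p_jx_{jn}$. The double sequence $(x_{mn})$ is $(\bar N,p,*;1,0)$ summable to $x$ if $t^{10}_{mn}\to x$. For $\lambda>0$, $\lambda_m=[\lambda m]$ is the integer part of $\lambda m$. $SVA_+$ is the set of nonnegative sequences $p=(p_j)$ with $p_0>0$ such that $\liminf_{m\to\infty}\left|\frac{P_{\lambda_m}}{P_m}-1\right|>0$ for all $\lambda>0$ with $\lambda\ne1$. *)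

(* Defs.v *)
From HB Require Import structures.
From mathcomp Require Export all_boot all_order all_algebra.
From mathcomp Require Export all_classical all_reals all_analysis.
Export Order.TTheory GRing.Theory Num.Theory.
Export numFieldNormedType.Exports.

Set Implicit Arguments.
Unset Strict Implicit.
Unset Printing Implicit Defensive.

Local Open Scope classical_set_scope.
Local Open Scope ring_scope.

Record IF_normed (R : realType) (V : lmodType R) (mu nu : V -> R -> R) : Prop :=
  IFNormed {
    IF_mu_itv : forall x t, 0 <= mu x t <= 1;
    IF_nu_itv : forall x t, 0 <= nu x t <= 1;
    IF_mu_le0 : forall x t, t <= 0 -> mu x t = 0;
    IF_mu_eq1 : forall x, (forall t, 0 < t -> mu x t = 1) <-> x = 0;
    IF_muZ : forall c x t, 0 < t -> c != 0 -> mu (c *: x) t = mu x (t / `|c|);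
    IF_muD : forall x y t s,
      Num.min (mu x t) (mu y s) <= mu (x + y) (t + s);
    IF_mu_pinfty : forall x, mu x t @[t --> +oo] --> (1 : R);
    IF_mu_0 : forall x, x != 0 -> mu x t @[t --> 0^'] --> (0 : R);
    IF_nu_le0 : forall x t, t <= 0 -> nu x t = 1;
    IF_nu_eq0 : forall x, (forall t, 0 < t -> nu x t = 0) <-> x = 0;
    IF_nuZ : forall c x t, 0 < t -> c != 0 -> nu (c *: x) t = nu x (t / `|c|);
    IF_nuD : forall x y t s,
      nu (x + y) (t + s) <= Num.max (nu x t) (nu y s);
    IF_nu_pinfty : forall x, nu x t @[t --> +oo] --> (0 : R);
    IF_nu_0 : forall x, x != 0 -> nu x t @[t --> 0^'] --> (1 : R)
  }.

Definition IF_cvg2 (R : realType) (V : lmodType R) (mu nu : V -> R -> R)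
    (x : nat -> nat -> V) (l : V) : Prop :=
  forall t eps : R, 0 < t -> 0 < eps < 1 ->
    exists n0 : nat, forall m n, (n0 <= m)%N -> (n0 <= n)%N ->
      1 - eps < mu (x m n - l) t /\ nu (x m n - l) t < eps.

(* Pringsheim lower and upper limits.  The inner infima (suprema) are monotone
   in [N], so the outer limit always exists in the extended reals. *)
Definition liminf2 (R : realType) (a : nat -> nat -> R) : \bar R :=
  limn (fun N => ereal_inf [set (a i.1 i.2)%:E | i in
    [set i : nat * nat | (N <= i.1)%N /\ (N <= i.2)%N]]).

Definition limsup2 (R : realType) (a : nat -> nat -> R) : \bar R :=
  limn (fun N => ereal_sup [set (a i.1 i.2)%:E | i in
    [set i : nat * nat | (N <= i.1)%N /\ (N <= i.2)%N]]).

(* [Psum p m] includes the term of index [m]. *)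
Definition Psum (R : realType) (p : nat -> R) (m : nat) : R :=
  \sum_(0 <= j < m.+1) p j.

Record weight (R : realType) (p : nat -> R) : Prop := Weight {
  weight_ge0 : forall j, 0 <= p j;
  weight_gt0 : 0 < p 0%N;
  weight_pinfty : Psum p m @[m --> \oo] --> +oo
}.

Definition lam (R : realType) (l : R) (m : nat) : nat := Num.truncn (l * m%:R).

(* The lower limit is taken in the extended reals, as it may be [+oo]. *)
Record SVA_plus (R : realType) (p : nat -> R) : Prop := SVAPlus {
  SVA_ge0 : forall j, 0 <= p j;
  SVA_gt0 : 0 < p 0%N;
  SVA_liminf : forall l : R, 0 < l -> l != 1 ->
    (0 < limn_einf (fun m => `|Psum p (lam l m) / Psum p m - 1|%:E))%E
}.

Definition t10 (R : realType) (V : lmodType R) (p : nat -> R)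
    (x : nat -> nat -> V) (m n : nat) : V :=
  (Psum p m)^-1 *: \sum_(0 <= j < m.+1) p j *: x j n.

Definition summable10 (R : realType) (V : lmodType R) (mu nu : V -> R -> R)
    (p : nat -> R) (x : nat -> nat -> V) (l : V) : Prop :=
  IF_cvg2 mu nu (t10 p x) l.

(* For [p] in [SVA_plus] and [0 < l < 1] the denominator is nonzero for all
   large [m]; the remaining [m] do not affect the Pringsheim limits. *)
Definition osc10 (R : realType) (V : lmodType R) (p : nat -> R)
    (x : nat -> nat -> V) (l : R) (m n : nat) : V :=
  (Psum p m - Psum p (lam l m))^-1 *:
    \sum_((lam l m).+1 <= j < m.+1) p j *: (x m n - x j n).

(* Divergence of the partial sums is automatic on [SVA_plus] (take [l = 2]). *)
Lemma SVA_plus_weight (R : realType) (p : nat -> R) : SVA_plus p -> weight p.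
Proof.
case=> p0 pp H; split=> //.
have ndP : {homo Psum p : m n / (m <= n)%N >-> m <= n}.
  move=> m n mn; rewrite /Psum [leRHS](@big_cat_nat _ _ _ m.+1)//=.
  by rewrite lerDl sumr_ge0.
have Pp0 m : p 0%N <= Psum p m.
  by rewrite (le_trans _ (ndP 0%N m _))// /Psum big_nat1.
have Pgt0 m : 0 < Psum p m by exact: lt_le_trans (Pp0 m).
have lam2 m : lam (2 : R) m = m.*2.
  by rewrite /lam -natrM mul2n natrK.
have := H 2 _ _; rewrite ltr0n => /(_ isT).
have -> : (2 : R) != 1 by rewrite (eqr_nat R 2 1).
move=> /(_ isT).
set u := (fun m : nat => _); rewrite limn_einf_lim.
rewrite (cvg_lim _ (ereal_nondecreasing_cvgn (nondecreasing_einfs u)))//.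
move=> /ereal_sup_gt[_ [N _ <-]] uN.
have uge m : (N <= m)%N -> (einfs u N <= u m)%E.
  by move=> Nm; apply: ereal_inf_lbound; exists m.
have [d d0 ud] : exists2 d : R, 0 < d & forall m, (N <= m)%N -> (d%:E <= u m)%E.
  case: (einfs u N) uN uge => [r r0 ur|_ ur|//]; first by exists r.
  by exists 1 => // m /ur; apply: le_trans; rewrite leey.
have step m : (N <= m)%N -> Psum p m + d * p 0%N <= Psum p m.*2.
  move=> Nm; have := ud m Nm; rewrite /u lam2 lee_fin ger0_norm.
    rewrite lerBrDr ler_pdivlMr// => h; apply: le_trans h.
    by rewrite mulrDl mul1r addrC lerD2r ler_pM2l.
  by rewrite subr_ge0 ler_pdivlMr// mul1r ndP// -addnn leq_addr.
have grow k : k%:R * (d * p 0%N) <= Psum p (2 ^ k * N)%N.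
  elim: k => [|k IH]; first by rewrite mul0r ltW.
  rewrite expnS -mulnA mul2n.
  apply: le_trans (step _ _); last by rewrite leq_pmull// expn_gt0.
  by rewrite -natr1 mulrDl mul1r lerD2r.
apply/cvgryPge => A.
pose k := Num.bound (A / (d * p 0%N)).
have dp : 0 < d * p 0%N by exact: mulr_gt0.
exists (2 ^ k * N)%N => // m /= km.
apply: le_trans (ndP _ _ km); apply: le_trans (grow k).
rewrite -ler_pdivrMr//; apply: ltW.
exact: le_lt_trans (ler_norm _) (truncnS_gt _).
Qed.

(* Main.v *)
Require Import Defs.

Set Implicit Arguments.
Unset Strict Implicit.
Unset Printing Implicit Defensive.

Local Open Scope classical_set_scope.
Local Open Scope ring_scope.

(** Write [T m n] for the weighted mean [t10 p x m n].  Splitting the sum that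
    defines [T m n] at the index [lam lambda m] gives, as soon as the two
    partial sums of the weights differ,
      [x m n = osc10 p x lambda m n + T m n + c m *: (T m n - T (lam lambda m) n)]
    with [c m = P (lam lambda m) / (P m - P (lam lambda m))]
    ([mean_osc_decomp]).  For [lambda < 1] the class [SVA_plus] says that
    [P (lam lambda m) / P m] stays away from [1], hence that [c] is bounded
    ([SVA_plus_gap]).  Both [T m n] and [T (lam lambda m) n] tend to [l], so for
    every fixed [lambda] the vectors [x m n - l] and [osc10 p x lambda m n]
    differ by a null double sequence ([mean_correction_null]).

    If [x] tends to [l], the oscillation therefore tends to [0] for one (indeed
    every) [lambda].  Conversely, the supremum condition says that for every
    tolerance some [lambda] makes the oscillation eventually small within this
    tolerance ([sup_liminf2_eqP]), and adding a null sequence carries this over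
    to [x m n - l].

    The two gradings are handled by one argument ([mean_osc_tauberian]): [mu]
    and [1 - nu] both satisfy the axioms [fuzzy_norm], convergence in the space
    is convergence for both ([IF_cvg2P]), and a change of sign reduces the
    infimum condition to a supremum condition ([inf_limsup2_eqP]). *)

(** * Pringsheim limits *)

Local Notation oo2 := (filter_prod \oo \oo).

Lemma pringsheimP (P : nat * nat -> Prop) :
  (\forall i \near oo2, P i) <->
  exists N, forall m n, (N <= m)%N -> (N <= n)%N -> P (m, n).
Proof.
split=> [[[A B] /= [[M _ MA] [N _ NB]] ABP]|[N NP]].
  exists (maxn M N) => m n; rewrite !geq_max => /andP[Mm _] /andP[_ Nn].
  by apply: ABP; split; [exact: MA | exact: NB].
exists ([set m | (N <= m)%N], [set n | (N <= n)%N]).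
  by split; exists N.
by move=> [m n] /= [Nm Nn]; exact: NP.
Qed.

Lemma pringsheim_fst (P : nat -> Prop) :
  (\forall m \near \oo, P m) -> \forall i \near oo2, P i.1.
Proof. exact: (cvg_fst (F := \oo) (G := \oo)). Qed.

Section pringsheim_limits.
Context {R : realType}.
Implicit Types a : nat -> nat -> R.

Let tail_inf a (N : nat) : \bar R :=
  ereal_inf [set (a i.1 i.2)%:E | i in
    [set i : nat * nat | (N <= i.1)%N /\ (N <= i.2)%N]].

Lemma nondecreasing_tail_inf a :
  {homo tail_inf a : m n / (m <= n)%N >-> (m <= n)%E}.
Proof.
move=> m n mn; apply: ereal_inf_le_tmp => _ [i [ni1 ni2] <-].
by exists i => //; split; exact: leq_trans mn _.
Qed.

Lemma liminf2E a : liminf2 a = ereal_sup (range (tail_inf a)).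
Proof.
apply/cvg_lim => //.
exact: (ereal_nondecreasing_cvgn (@nondecreasing_tail_inf a)).
Qed.

Lemma liminf2_gt a (c : \bar R) : (c < liminf2 a)%E ->
  \forall i \near oo2, (c < (a i.1 i.2)%:E)%E.
Proof.
rewrite liminf2E => /ereal_sup_gt[_ [N _ <-]] cN.
apply/pringsheimP; exists N => m n Nm Nn /=.
by apply: lt_le_trans cN _; apply: ereal_inf_lbound; exists (m, n).
Qed.

Lemma liminf2_ge a (c : \bar R) :
  (\forall i \near oo2, (c <= (a i.1 i.2)%:E)%E) -> (c <= liminf2 a)%E.
Proof.
move=> /pringsheimP[N ca]; rewrite liminf2E.
apply: (le_trans _ (ereal_sup_ubound (ex_intro2 _ _ N I erefl))).
by apply: le_ereal_inf_tmp => _ [[m n] [/= Nm Nn] <-]; exact: (ca m n).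
Qed.

Lemma liminf2_le a (M : R) : (forall m n, a m n <= M) -> (liminf2 a <= M%:E)%E.
Proof.
move=> aM; rewrite leNgt; apply/negP => /liminf2_gt/pringsheimP[N].
by move=> /(_ N N (leqnn _) (leqnn _)); rewrite ltNge lee_fin aM.
Qed.

Lemma limsup2N a : limsup2 a = (- liminf2 (fun m n => - a m n)%R)%E.
Proof.
rewrite /liminf2 -limeN; last first.
  apply: ereal_nondecreasing_is_cvgn.
  exact: (@nondecreasing_tail_inf (fun m n => - a m n)).
congr (lim (_ @ \oo)); apply/funext => N; rewrite ereal_supEN.
by congr (- ereal_inf _)%E; rewrite image_comp.
Qed.

(** Eventual inequalities replace the nested extended-real limits: a supremum
    of lower limits of functions bounded by [M] equals [M] exactly when it is
    approached, and a lower limit exceeds [M - eps] only if the values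
    eventually do. *)
Lemma sup_liminf2_eqP (K : Type) (D : set K) (a : K -> nat -> nat -> R) (M : R) :
  (forall k m n, a k m n <= M) ->
  ereal_sup [set liminf2 (a k) | k in D] = M%:E <->
  (forall eps, 0 < eps -> exists2 k, D k &
     \forall i \near oo2, M - eps < a k i.1 i.2).
Proof.
move=> aM; split=> [supM eps eps0|H].
  have : ((M - eps)%:E < ereal_sup [set liminf2 (a k) | k in D])%E.
    by rewrite supM lte_fin ltrBlDr ltrDl.
  move=> /ereal_sup_gt[_ [k Dk <-]] /liminf2_gt ka.
  by exists k.
apply/eqP; rewrite eq_le; apply/andP; split.
  by apply: ge_ereal_sup => _ [k _ <-]; exact: liminf2_le.
apply/lee_addgt0Pr => eps /H[k Dk ka].
rewrite -leeBlDr//; apply: le_trans (ereal_sup_ubound (ex_intro2 _ _ k Dk erefl)).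
by apply: liminf2_ge; apply: filterS ka => i /ltW; rewrite -EFinB lee_fin.
Qed.

Lemma inf_limsup2_eqP (K : Type) (D : set K) (a : K -> nat -> nat -> R) (M : R) :
  (forall k m n, M <= a k m n) ->
  ereal_inf [set limsup2 (a k) | k in D] = M%:E <->
  (forall eps, 0 < eps -> exists2 k, D k &
     \forall i \near oo2, a k i.1 i.2 < M + eps).
Proof.
move=> Ma.
have -> : ereal_inf [set limsup2 (a k) | k in D] =
    (- ereal_sup [set liminf2 (fun m n => - a k m n)%R | k in D])%E.
  rewrite ereal_infEN image_comp; congr (- ereal_sup _)%E.
  by apply: eq_imagel => k _ /=; rewrite limsup2N oppeK.
have Na k m n : - a k m n <= - M by rewrite lerN2.
split=> [/eqP|H].
  rewrite eqe_oppLR -EFinN => /eqP/(sup_liminf2_eqP D Na) H eps /H[k Dk ka].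
  by exists k => //; apply: filterS ka => i; rewrite -opprD ltrN2.
apply/eqP; rewrite eqe_oppLR -EFinN; apply/eqP/(sup_liminf2_eqP D Na).
move=> eps /H[k Dk ka].
by exists k => //; apply: filterS ka => i; rewrite -opprD ltrN2.
Qed.

End pringsheim_limits.

(** * Null families for a fuzzy norm *)

(** The part of the axioms of [mu] that is also satisfied by [1 - nu]. *)
Record fuzzy_norm (R : realType) (V : lmodType R) (N : V -> R -> R) : Prop :=
  FuzzyNorm {
    fuzzy_le1 : forall z t, N z t <= 1;
    fuzzy_norm0 : forall t, 0 < t -> N 0 t = 1;
    fuzzy_normZ : forall c z t, 0 < t -> c != 0 -> N (c *: z) t = N z (t / `|c|);
    fuzzy_normD : forall y z t s, Num.min (N y t) (N z s) <= N (y + z) (t + s)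
  }.

Definition fuzzy_null (R : realType) (V : lmodType R) (N : V -> R -> R)
    (I : Type) (F : set_system I) (z : I -> V) : Prop :=
  forall t eps : R, 0 < t -> 0 < eps -> \forall i \near F, 1 - eps < N (z i) t.

Section fuzzy_norm_theory.
Context {R : realType} {V : lmodType R} {N : V -> R -> R}.
Hypothesis hN : fuzzy_norm N.

Lemma fuzzy_norm_mono z s t : s <= t -> N z s <= N z t.
Proof.
rewrite le_eqVlt => /predU1P[->//|st].
have := fuzzy_normD hN z 0 s (t - s).
by rewrite (fuzzy_norm0 hN) ?subr_gt0// min_l ?(fuzzy_le1 hN)// addr0 addrC subrK.
Qed.

(** Splitting the scale in halves leaves the tolerance [eps] intact, because
    the triangle inequality is stated with a minimum. *)
Lemma fuzzy_normD_gt (y z : V) t eps :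
  1 - eps < N y (t / 2) -> 1 - eps < N z (t / 2) -> 1 - eps < N (y + z) t.
Proof.
move=> yt zt; rewrite [X in N _ X](splitr t).
by apply: lt_le_trans (fuzzy_normD hN _ _ _ _); rewrite lt_min yt.
Qed.

Section families.
Context {I : Type} {F : set_system I} {FF : Filter F}.
Implicit Types y z : I -> V.

Lemma fuzzy_nullD y z :
  fuzzy_null N F y -> fuzzy_null N F z -> fuzzy_null N F (fun i => y i + z i).
Proof.
move=> y0 z0 t eps t0 eps0; have t20 : 0 < t / 2 by rewrite divr_gt0.
have := y0 _ _ t20 eps0; have := z0 _ _ t20 eps0.
by apply: filterS2 => i zi yi; exact: fuzzy_normD_gt.
Qed.

Lemma fuzzy_null_eq y z :
  (\forall i \near F, y i = z i) -> fuzzy_null N F y -> fuzzy_null N F z.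
Proof.
by move=> yz y0 t eps t0 /(y0 _ _ t0); apply: filterS2 yz => i ->.
Qed.

(** A bounded factor only rescales the argument [t], which monotonicity of
    [N z] absorbs; vanishing factors are outside the homogeneity axiom and use
    the value at the origin. *)
Lemma fuzzy_nullZ (c : I -> R) C z : (\forall i \near F, `|c i| <= C) ->
  fuzzy_null N F z -> fuzzy_null N F (fun i => c i *: z i).
Proof.
move=> cC z0 t eps t0 eps0.
(* The shift by one makes the bound positive even when [C <= 0]. *)
have C0 : 0 < `|C| + 1 by rewrite ltr_wpDl.
have := z0 _ _ (divr_gt0 t0 C0) eps0.
apply: filterS2 cC => i ciC zi.
have [->|ci0] := eqVneq (c i) 0.
  by rewrite scale0r (fuzzy_norm0 hN)// ltrBlDr ltrDl.
rewrite (fuzzy_normZ hN)//; apply: lt_le_trans zi _; apply: fuzzy_norm_mono.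
rewrite ler_pM2l// lef_pV2 ?posrE ?normr_gt0//.
by apply: (le_trans ciC); rewrite (le_trans (ler_norm _))// lerDl.
Qed.

Lemma fuzzy_nullN z : fuzzy_null N F z -> fuzzy_null N F (fun i => - z i).
Proof.
move=> z0; apply: (@fuzzy_null_eq (fun i => -1 *: z i)).
  by apply: nearW => i; rewrite scaleN1r.
by apply: (@fuzzy_nullZ _ 1) => //; apply: nearW => i; rewrite normrN1.
Qed.

End families.

End fuzzy_norm_theory.

Section intuitionistic_norm.
Context {R : realType} {V : lmodType R} {mu nu : V -> R -> R}.

Lemma IF_cvg2P (x : nat -> nat -> V) (l : V) :
  IF_cvg2 mu nu x l <->
  fuzzy_null mu oo2 (fun i => x i.1 i.2 - l) /\
  fuzzy_null (fun z t => 1 - nu z t) oo2 (fun i => x i.1 i.2 - l).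
Proof.
split=> [xl|[xmu xnu] t eps t0 /andP[eps0 _]]; last first.
  apply/(pringsheimP (fun i => 1 - eps < mu (x i.1 i.2 - l) t /\
    nu (x i.1 i.2 - l) t < eps)).
  have := xnu t eps t0 eps0; have := xmu t eps t0 eps0.
  by apply: filterS2 => i mi; rewrite ltrD2l ltrN2.
(* The minimum with [1 / 2] brings any tolerance below [1]. *)
have {}xl t eps : 0 < t -> 0 < eps -> \forall i \near oo2,
    1 - eps < mu (x i.1 i.2 - l) t /\ nu (x i.1 i.2 - l) t < eps.
  move=> t0 eps0; have e01 : 0 < Num.min eps 2^-1 < 1.
    by rewrite lt_min eps0 invr_gt0 ltr0n gt_min invf_lt1 ?ltr0n// ltr1n orbT.
  have [n0 n0P] := xl _ _ t0 e01.
  apply/pringsheimP; exists n0 => m n n0m n0n /=.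
  have [mmu mnu] := n0P m n n0m n0n; split; last first.
    by apply: lt_le_trans mnu _; rewrite ge_min lexx.
  by apply: le_lt_trans mmu; rewrite lerD2l lerN2 ge_min lexx.
split=> t eps t0 eps0; apply: filterS (xl _ _ t0 eps0) => i [] //.
by rewrite ltrD2l ltrN2.
Qed.

Hypothesis hV : IF_normed mu nu.

Lemma fuzzy_norm_mu : fuzzy_norm mu.
Proof.
split=> [z t|t|c z t|y z t s].
- by have /andP[] := IF_mu_itv hV z t.
- exact: (IF_mu_eq1 hV 0).2.
- exact: IF_muZ hV _ _ _.
- exact: IF_muD hV _ _ _ _.
Qed.

Lemma fuzzy_norm_nu : fuzzy_norm (fun z t => 1 - nu z t).
Proof.
split=> [z t|t t0|c z t t0 c0|y z t s].
- by rewrite lerBlDr lerDl; have /andP[] := IF_nu_itv hV z t.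
- by rewrite ((IF_nu_eq0 hV 0).2 erefl _ t0) subr0.
- by rewrite (IF_nuZ hV).
- have := IF_nuD hV y z t s.
  by rewrite le_max ge_min => /orP[] h; rewrite !lerD2l !lerN2 h ?orbT.
Qed.

End intuitionistic_norm.

(** * Weights of class SVA *)

Section weights.
Context {R : realType} (p : nat -> R) (hp : SVA_plus p).

Lemma Psum_mono : {homo Psum p : m n / (m <= n)%N >-> m <= n}.
Proof.
move=> m n mn; rewrite /Psum [leRHS](@big_cat_nat _ _ _ m.+1)//=.
by rewrite lerDl sumr_ge0// => j _; exact: SVA_ge0 hp j.
Qed.

Lemma Psum_gt0 m : 0 < Psum p m.
Proof.
apply: lt_le_trans (Psum_mono (leq0n m)).
by rewrite /Psum big_nat1; exact: SVA_gt0 hp.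
Qed.

Lemma lam_le (k : R) m : k <= 1 -> (lam k m <= m)%N.
Proof.
move=> k1; rewrite /lam truncn_le_nat; apply: (@le_lt_trans _ _ m%:R).
  by rewrite ler_piMl.
by rewrite ltr_nat.
Qed.

(** This makes [t10 p x (lam k m) n] inherit the limit of [t10 p x m n]. *)
Lemma lam_cvg (k : R) : 0 < k -> lam k m @[m --> \oo] --> \oo.
Proof.
move=> k0 A [N _ NA]; exists (Num.bound (N%:R / k)) => //= m /= bm.
apply: NA; rewrite /= /lam truncn_ge_nat; last by rewrite mulr_ge0// ltW.
rewrite mulrC -ler_pdivrMr//.
apply: (le_trans _ (_ : (Num.bound (N%:R / k))%:R <= _)).
  exact/ltW/(le_lt_trans (ler_norm _))/truncnS_gt.
by rewrite ler_nat.
Qed.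

(** For [k < 1] the lower limit defining the class is a relative gap between
    the partial sums, uniform in [m]. *)
Lemma SVA_plus_gap (k : R) : 0 < k < 1 -> exists2 d : R, 0 < d &
  \forall m \near \oo, d * Psum p m <= Psum p m - Psum p (lam k m).
Proof.
move=> /andP[k0 k1]; have := SVA_liminf hp k0 (negbT (lt_eqF k1)).
rewrite limn_einf_lim.
set u := (fun m : nat => _).
rewrite (cvg_lim _ (ereal_nondecreasing_cvgn (nondecreasing_einfs u)))//.
move=> /ereal_sup_gt[_ [N _ <-]] uN.
have [d d0 dN] : exists2 d : R, 0 < d & (d%:E <= einfs u N)%E.
  case: (einfs u N) uN => [r r0|_|//]; first by exists r.
  by exists 1 => //; rewrite leey.
exists d => //; exists N => // m /= Nm.
have : (d%:E <= u m)%E.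
  by apply: le_trans dN _; apply: ereal_inf_lbound; exists m.
rewrite /u lee_fin distrC ger0_norm; last first.
  by rewrite subr_ge0 ler_pdivrMr ?Psum_gt0// mul1r Psum_mono// lam_le// ltW.
rewrite -(ler_pM2r (Psum_gt0 m)) mulrBl mul1r divfK//.
by rewrite gt_eqF// Psum_gt0.
Qed.

End weights.

(** * Means and oscillations *)

Lemma sum_nat_sub (U : zmodType) (f : nat -> U) m n : (m <= n)%N ->
  \sum_(0 <= j < n.+1) f j - \sum_(0 <= j < m.+1) f j = \sum_(m.+1 <= j < n.+1) f j.
Proof.
by move=> mn; rewrite (@big_cat_nat _ _ _ m.+1 0 n.+1)//= addrAC subrr add0r.
Qed.

Section means.
Context {R : realType} {V : lmodType R}.
Variables (p : nat -> R) (x : nat -> nat -> V).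

(** The amount by which the weighted mean of [x j n] over the block
    [lam k m < j <= m] exceeds the mean over all [j <= m]. *)
Definition mean_correction (k : R) (m n : nat) : V :=
  (Psum p (lam k m) / (Psum p m - Psum p (lam k m))) *:
    (t10 p x m n - t10 p x (lam k m) n).

(** [osc10] is [x m n] minus the weighted mean of [x j n] over the block
    [lam k m < j <= m], and the weighted sum over the block is the difference of
    two initial sums, each a multiple of a mean [t10]. *)
Lemma mean_osc_decomp (k : R) m n : (lam k m <= m)%N ->
  Psum p (lam k m) != 0 -> Psum p m != 0 -> Psum p m != Psum p (lam k m) ->
  x m n = osc10 p x k m n + (t10 p x m n + mean_correction k m n).
Proof.
move=> km Pk0 Pm0 Pmk; rewrite /osc10 /mean_correction.
pose S j := \sum_(0 <= i < j.+1) p i *: x i n.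
have SE j : Psum p j != 0 -> S j = Psum p j *: t10 p x j n.
  by move=> Pj; rewrite /t10 scalerA divff// scale1r.
have -> : \sum_((lam k m).+1 <= j < m.+1) p j *: (x m n - x j n) =
    (Psum p m - Psum p (lam k m)) *: x m n - (S m - S (lam k m)).
  rewrite /S /Psum !sum_nat_sub// scaler_suml -sumrB.
  by apply: eq_bigr => j _; rewrite scalerBr.
rewrite !SE//; set D := Psum p m - _; have D0 : D != 0 by rewrite subr_eq0.
have -> : Psum p m *: t10 p x m n - Psum p (lam k m) *: t10 p x (lam k m) n =
    D *: (t10 p x m n +
          (Psum p (lam k m) / D) *: (t10 p x m n - t10 p x (lam k m) n)).
  rewrite scalerDr scalerA [D * _]mulrC divfK// scalerBr scalerBl addrA.
  by rewrite subrK.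
by rewrite -scalerBr scalerA mulVf// scale1r subrK.
Qed.

Context {N : V -> R -> R}.
Hypotheses (hN : fuzzy_norm N) (hp : SVA_plus p).

Lemma mean_osc_decomp_near (k : R) : 0 < k < 1 ->
  \forall i \near oo2,
    x i.1 i.2 = osc10 p x k i.1 i.2 + (t10 p x i.1 i.2 + mean_correction k i.1 i.2).
Proof.
move=> k01; have [d d0 gap] := SVA_plus_gap hp k01.
have := pringsheim_fst gap; apply: filterS => i gapi.
have Pgt0 := Psum_gt0 hp.
apply: mean_osc_decomp; rewrite ?gt_eqF//.
  by apply: lam_le; have /andP[_ /ltW] := k01.
by rewrite -subr_gt0; apply: lt_le_trans gapi; exact: mulr_gt0.
Qed.

Lemma mean_correction_null (k : R) (l : V) : 0 < k < 1 ->
  fuzzy_null N oo2 (fun i => t10 p x i.1 i.2 - l) ->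
  fuzzy_null N oo2
    (fun i => t10 p x i.1 i.2 + mean_correction k i.1 i.2 - l).
Proof.
move=> k01 tl; have [d d0 gap] := SVA_plus_gap hp k01.
have Pgt0 := Psum_gt0 hp.
have tkl : fuzzy_null N oo2 (fun i => t10 p x (lam k i.1) i.2 - l).
  move=> t eps t0 eps0; have /andP[k0 _] := k01.
  have sub : (lam k i.1, i.2) @[i --> oo2] --> oo2.
    have lam_fst : lam k i.1 @[i --> oo2] --> \oo.
      exact: cvg_comp (cvg_fst (F := \oo) (G := \oo)) (lam_cvg k0).
    exact: cvg_pair lam_fst (cvg_snd (F := \oo) (G := \oo)).
  exact: (sub _ (tl t eps t0 eps0)).
have ckl : fuzzy_null N oo2 (fun i => mean_correction k i.1 i.2).
  apply: (@fuzzy_nullZ _ _ _ hN _ _ _ _ d^-1); last first.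
    apply: fuzzy_null_eq (fuzzy_nullD hN tl (fuzzy_nullN hN tkl)).
    by apply: nearW => i; rewrite opprB addrA subrK.
  have := pringsheim_fst gap; apply: filterS => i gapi.
  have D0 : 0 < Psum p i.1 - Psum p (lam k i.1).
    by apply: lt_le_trans gapi; exact: mulr_gt0.
  rewrite ger0_norm; last by apply: divr_ge0; exact: ltW.
  rewrite ler_pdivrMr// ler_pdivlMl//; apply: le_trans gapi.
  by rewrite ler_pM2l// -subr_ge0; exact: ltW.
apply: fuzzy_null_eq (fuzzy_nullD hN tl ckl).
by apply: nearW => i; rewrite addrAC.
Qed.

(** The Tauberian equivalence for a single grading.  The quantifiers on the
    right allow [k] to depend on the scale and on the tolerance. *)
Lemma mean_osc_tauberian (l : V) :
  fuzzy_null N oo2 (fun i => t10 p x i.1 i.2 - l) ->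
  fuzzy_null N oo2 (fun i => x i.1 i.2 - l) <->
  (forall t eps : R, 0 < t -> 0 < eps -> exists2 k : R, 0 < k < 1 &
     \forall i \near oo2, 1 - eps < N (osc10 p x k i.1 i.2) t).
Proof.
move=> tl; split=> [xl t eps t0 eps0|H t eps t0 eps0].
  have k01 : 0 < (2^-1 : R) < 1 by rewrite invr_gt0 ltr0n invf_lt1 ?ltr0n// ltr1n.
  exists 2^-1 => //; move: t eps t0 eps0.
  apply: fuzzy_null_eq
    (fuzzy_nullD hN xl (fuzzy_nullN hN (mean_correction_null k01 tl))).
  apply: filterS (mean_osc_decomp_near k01) => i ->.
  by rewrite opprB addrA subrK addrK.
have t20 : 0 < t / 2 by rewrite divr_gt0.
have [k k01 osc] := H _ _ t20 eps0.
have cor := mean_correction_null k01 tl t20 eps0.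
apply: filterS3 osc cor (mean_osc_decomp_near k01) => i osci cori ->.
by rewrite -addrA; exact: fuzzy_normD_gt.
Qed.

End means.

Theorem theorem23 (R : realType) (V : lmodType R) (mu nu : V -> R -> R)
    (hV : IF_normed mu nu) (p : nat -> R) (hp : SVA_plus p)
    (x : nat -> nat -> V) (l : V) (hx : summable10 mu nu p x l) :
  IF_cvg2 mu nu x l <->
  (forall t : R, 0 < t ->
    ereal_sup [set liminf2 (fun m n => mu (osc10 p x lambda m n) t) |
               lambda in [set lambda : R | 0 < lambda < 1]] = 1%E /\
    ereal_inf [set limsup2 (fun m n => nu (osc10 p x lambda m n) t) |
               lambda in [set lambda : R | 0 < lambda < 1]] = 0%E).
Proof.
have [tmu tnu] := (IF_cvg2P _ _).1 hx.
have tauber_mu := mean_osc_tauberian (fuzzy_norm_mu hV) hp tmu.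
have tauber_nu := mean_osc_tauberian (fuzzy_norm_nu hV) hp tnu.
have supP t := sup_liminf2_eqP (M := 1) [set k : R | 0 < k < 1]
  (fun k m n => fuzzy_le1 (fuzzy_norm_mu hV) (osc10 p x k m n) t).
have nu0 z t : 0 <= nu z t by have /andP[] := IF_nu_itv hV z t.
have infP t := inf_limsup2_eqP (M := 0) [set k : R | 0 < k < 1]
  (fun k m n => nu0 (osc10 p x k m n) t).
rewrite IF_cvg2P; split=> [[/tauber_mu xmu /tauber_nu xnu] t t0|H].
  split; first by apply/supP => eps; exact: xmu.
  apply/infP => eps /(xnu _ _ t0)[k k01 osc]; exists k => //.
  by apply: filterS osc => i; rewrite ltrD2l ltrN2 add0r.
split.
  by apply/tauber_mu => t eps /H[/supP + _]; exact.
apply/tauber_nu => t eps /H[_ /infP /[apply]] [k k01 osc]; exists k => //.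
by apply: filterS osc => i; rewrite ltrD2l ltrN2 add0r.
Qed.
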